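(* Let $\mathbf{X}$ be a real vector space with norm $|\cdot|$, let $1<p<\infty$ and $\mathbf{Z}=\{(x,y)\in\mathbf{X}\times\mathbb{R}_+:|x|\le y\}$. For all $(x,y)\in\mathbf{Z}$, all integers $T\ge0$ and every simple $\mathbf{X}$-valued martingale $M$ starting at $M_0=x$, \[ E\Big[(|M|^*_T)^p\vee y^p-\big(\tfrac{p}{p-1}\big)^p|M_T|^p\Big]\le \begin{cases} y^p-\big(\tfrac{p}{p-1}\big)^p|x|^p & \text{if } |x|<\tfrac{p-1}{p}y,\\[2pt] p\,y^p-\tfrac{p^2}{p-1}|x|\,y^{p-1} & \text{if } |x|\ge\tfrac{p-1}{p}y,\end{cases} \] and the right-hand side is optimal: for each $(x,y)\in\mathbf{Z}$ it is the smallest constant for which the inequality holds for all $T\ge0$ and all such $M$. In particular, for $y=|x|$, \[ E\Big[(|M|^*_T)^p-\big(\tfrac{p}{p-1}\big)^p|M_T|^p\Big]\le-\tfrac{p}{p-1}|x|^p\le0, \] and thus $\big\||M|^*_T\big\|_p\le\tfrac{p}{p-1}\|M_T\|_p$.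
   Context: A martingale is simple if it takes finitely many values (so all expectations are finite sums). $|M|^*_T=\max_{0\le t\le T}|M_t|$; $\|\xi\|_p=(E[|\xi|^p])^{1/p}$; $a\vee b=\max\{a,b\}$; $\mathbb{R}_+=[0,\infty)$. *)

(* Defs.v *)
From HB Require Import structures.
From mathcomp Require Export all_boot all_order all_algebra.
From mathcomp Require Export all_classical all_reals all_analysis.

Set Implicit Arguments.
Unset Strict Implicit.
Unset Printing Implicit Defensive.

Import Order.TTheory GRing.Theory Num.Theory.
Import numFieldNormedType.Exports.

Local Open Scope classical_set_scope.
Local Open Scope ring_scope.

Section SimpleMartingales.
Context {R : realType} {X : normedModType R}.
Context {d : measure_display} {Omega : measurableType d}.
Implicit Types (P : probability Omega R) (F : nat -> set (set Omega)).
Implicit Types (f g : Omega -> X) (M : nat -> Omega -> X).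

Definition filtration F : Prop :=
  [/\ forall t, sigma_algebra setT (F t),
      forall t, F t `<=` measurable &
      forall s t, (s <= t)%N -> F s `<=` F t].

Definition borel_measurable (G : set (set Omega)) f : Prop :=
  forall B : set X, <<s @open X >> B -> G (f @^-1` B).

(* [E [f 1_A]] in [X], for [f] taking finitely many values. On other functions
   the sum may be the default value 0 of a sum with infinite support; finiteness
   of the range is always assumed alongside. *)
Definition simple_expectation P (A : set Omega) f : X :=
  \sum_(v \in range f) fine (P (A `&` f @^-1` [set v])) *: v.

(* [g] is a version of [E [f | G]]. *)
Definition is_cond_expectation P (G : set (set Omega)) f g : Prop :=
  borel_measurable G g /\
  forall A, G A -> simple_expectation P A f = simple_expectation P A g.

(* Simple martingale [(M_t)_{0 <= t <= T}] with [M_0 = x]; the values [M t] for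
   [T < t] are unconstrained and never used. *)
Definition simple_martingale P F (T : nat) (x : X) M : Prop :=
  [/\ filtration F,
      forall w, M 0%N w = x,
      forall t, (t <= T)%N -> finite_set (range (M t)),
      forall t, (t <= T)%N -> borel_measurable (F t) (M t) &
      forall s t, (s <= t <= T)%N -> is_cond_expectation P (F s) (M t) (M s)].

Definition max_norm M (T : nat) (w : Omega) : R :=
  \big[Num.max/0]_(0 <= t < T.+1) `|M t w|.

End SimpleMartingales.

Definition doob_domain {R : realType} {X : normedModType R} : set (X * R) :=
  [set z | 0 <= z.2 /\ `|z.1| <= z.2].

Definition doob_bound {R : realType} {X : normedModType R}
    (p : R) (x : X) (y : R) : R :=
  if `|x| < (p - 1) / p * y
  then y `^ p - (p / (p - 1)) `^ p * `|x| `^ p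
  else p * y `^ p - p ^+ 2 / (p - 1) * `|x| * y `^ (p - 1).

(* [C] bounds the expectation for every horizon and every simple martingale
   started at [x], on every filtered probability space. *)
Definition doob_constant {R : realType} {X : normedModType R}
    (p : R) (x : X) (y C : R) : Prop :=
  forall (d : measure_display) (Omega : measurableType d)
    (P : probability Omega R) (F : nat -> set (set Omega))
    (T : nat) (M : nat -> Omega -> X),
    simple_martingale P F T x M ->
    ('E_P[fun w => (Num.max (max_norm M T w `^ p) (y `^ p)
                    - (p / (p - 1)) `^ p * `|M T w| `^ p)%R] <= C%:E)%E.

(* Main.v *)
Require Import Defs.
From HB Require Import structures.
From mathcomp Require Import ring lra.

Set Implicit Arguments.
Unset Strict Implicit.
Unset Printing Implicit Defensive.

Import Order.TTheory GRing.Theory Num.Theory.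
Import numFieldNormedType.Exports.

Local Open Scope classical_set_scope.
Local Open Scope ring_scope.

(* Write c = p / (p - 1), S_t for the running maximum of |M| started at y, and
   u(m, s) = p s^p - p c m s^(p-1).  Young's inequality gives both
   s^p - c^p m^p <= u(m, s) and u(m, max(s, m)) <= u(m, s); since u is affine and
   nonincreasing in m and |M| is a submartingale, E[u(|M_t|, S_t)] is nonincreasing
   in t, whence the upper bound u(|x|, y).  For c|x| < y one applies this with
   c|x| in place of y, where u vanishes.

   If c|x| <= y the constant martingale is optimal.  Otherwise one lets |M| move on
   the ray through x: first to y or down to ay, then repeatedly from the current
   maximum s either up to rs or down to as, stopping after a downward move, where
   a is slightly larger than 1/c.  The payoff of stopping is then
   s^p (1 - (ca)^p) and the contribution of the paths that never stop decays
   geometrically; letting the number of steps go to infinity, then r -> 1 and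
   a -> 1/c, the expected payoff tends to u(|x|, y). *)

(** * Young's inequality and the majorant *)

Section Majorant.
Context {R : realType} (p : R).
Hypothesis p_gt1 : 1 < p.
Implicit Types m s : R.

Let p_gt0 : 0 < p. Proof. exact: lt_trans ltr01 p_gt1. Qed.
Let p1_gt0 : 0 < p - 1. Proof. by rewrite subr_gt0. Qed.

(** With c = p / (p - 1), this is the tangent in [m] to the concave payoff s^p - (c m)^p at m = s /
    c, where both vanish. At (|x|, y) it is the second branch of [doob_bound]. *)
Definition doob_majorant m s : R :=
  p * s `^ p - p ^+ 2 / (p - 1) * m * s `^ (p - 1).

(** Young's inequality for the product of m and s^(p-1), with exponents p and p / (p - 1),
    multiplied by p. *)
Lemma young_powR m s : 0 <= m -> 0 <= s ->
  p * m * s `^ (p - 1) <= m `^ p + (p - 1) * s `^ p.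
Proof.
move=> m0 s0.
have q0 : 0 < p / (p - 1) by rewrite divr_gt0.
have pq : p^-1 + (p / (p - 1))^-1 = 1 by field; rewrite !gt_eqF.
have := conjugate_powR m0 (powR_ge0 s (p - 1)) p_gt0 q0 pq.
rewrite -powRrM (_ : (p - 1) * (p / (p - 1)) = p); last by field; rewrite gt_eqF.
rewrite -(ler_pM2l p_gt0) mulrA => /le_trans; apply.
by rewrite le_eqVlt; apply/orP; left; apply/eqP; field; rewrite !gt_eqF.
Qed.

Lemma doob_majorant_maxr m s : 0 <= m -> 0 <= s ->
  doob_majorant m (Num.max s m) <= doob_majorant m s.
Proof.
move=> m0 s0; case: (leP m s) => [//|sm].
rewrite /doob_majorant -[p ^+ 2 / _ * m * m `^ _]mulrA mulr_powRB1//.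
(* For s < m, the gap u(m, s) - u(m, m) is p / (p - 1) times the gap in Young's inequality. *)
have := young_powR m0 s0; rewrite -(ler_pM2l (_ : 0 < p / (p - 1))) ?divr_gt0//.
set A := _ `^ p; set B := _ `^ (p - 1); set D := s `^ p => h.
rewrite -subr_ge0; move: h; rewrite -subr_ge0 => /le_trans; apply.
by rewrite le_eqVlt; apply/orP; left; apply/eqP; field; rewrite gt_eqF.
Qed.

Lemma payoff_le_majorant m s : 0 <= m -> 0 <= s ->
  s `^ p - (p / (p - 1)) `^ p * m `^ p <= doob_majorant m s.
Proof.
move=> m0 s0; have q0 : 0 <= p / (p - 1) by rewrite divr_ge0// ltW.
(* Young's inequality at (c m, s) instead of (m, s). *)
have := young_powR (mulr_ge0 q0 m0) s0; rewrite (powRM _ q0 m0).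
rewrite (_ : p * (p / (p - 1) * m) = p ^+ 2 / (p - 1) * m); last by ring.
by rewrite /doob_majorant; lra.
Qed.

End Majorant.

(** * Functions of finite range and their measurability *)

Section StepFunctions.
Context {Omega : pointedType}.
Implicit Types (G : set (set Omega)).

(** Preimages of all subsets are required, not only of Borel ones: over a sigma-algebra and for
    finite range this amounts to measurable fibres, and it is stable under composition with
    arbitrary functions. *)
Definition step_measurable {Y : Type} G (f : Omega -> Y) : Prop :=
  finite_set (range f) /\ forall B, G (f @^-1` B).

Lemma sub_step_measurable {Y : Type} G G' (f : Omega -> Y) :
  G `<=` G' -> step_measurable G f -> step_measurable G' f.
Proof. by move=> GG' [fin mf]; split=> // B; exact/GG'/mf. Qed.

Lemma step_measurable_comp {Y Z : Type} G (f : Omega -> Y) (g : Y -> Z) :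
  step_measurable G f -> step_measurable G (g \o f).
Proof.
move=> [fin mf]; split; last by move=> B; rewrite comp_preimage; exact: mf.
apply: (@sub_finite_set _ _ (g @` range f)); last exact: finite_image.
by move=> _ [w _ <-]; exists (f w) => //; exists w.
Qed.

Lemma step_measurable_fibers {Y : choiceType} G (f : Omega -> Y) :
  sigma_algebra setT G -> finite_set (range f) ->
  (forall v, G (f @^-1` [set v])) -> step_measurable G f.
Proof.
move=> sG fin mf; split=> // B.
have -> : f @^-1` B = \bigcup_(v in B `&` range f) f @^-1` [set v].
  apply/seteqP; split=> [w Bw|w [v [Bv _] /= ->]] //.
  by exists (f w) => //; split=> //; exists w.
(* The measurable sets of the type generated by [G] are [G] itself, which gives access to closure
   under finite unions. *)
rewrite -(measurable_g_measurableTypeE sG).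
apply: (fin_bigcup_measurable (T := g_sigma_algebraType G)).
  exact: finite_setIr.
by move=> v _; rewrite measurable_g_measurableTypeE.
Qed.

Lemma step_measurable_pair {Y Z : choiceType} G (f : Omega -> Y) (g : Omega -> Z) :
  sigma_algebra setT G -> step_measurable G f -> step_measurable G g ->
  step_measurable G (fun w => (f w, g w)).
Proof.
move=> sG [finf mf] [fing mg]; apply: step_measurable_fibers => //.
  apply: (@sub_finite_set _ _ (range f `*` range g)); last exact: finite_setX.
  by move=> _ [w _ <-]; split; exists w.
move=> [a b].
have -> : (fun w => (f w, g w)) @^-1` [set (a, b)] =
    f @^-1` [set a] `&` g @^-1` [set b].
  by apply/seteqP; split=> w /= [-> ->].
rewrite -(measurable_g_measurableTypeE sG).
by apply: (measurableI (s := g_sigma_algebraType G)); rewrite measurable_g_measurableTypeE.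
Qed.

End StepFunctions.

(** * Expectations as finite sums, and conditional Jensen for the norm *)

Section Expectation.
Context {R : realType} {d : measure_display} {Omega : measurableType d}.
Variable P : probability Omega R.

Lemma finite_range_seq {T : Type} {Y : choiceType} (f : T -> Y) :
  finite_set (range f) -> exists2 s : seq Y, uniq s & forall w, f w \in s.
Proof.
move=> /finite_seqP[s sE]; exists (undup s); first exact: undup_uniq.
move=> w; rewrite mem_undup.
by have : range f (f w) by []; rewrite sE.
Qed.

Lemma sum_eq_indicator {V : zmodType} {Y : choiceType} (s : seq Y) (v : Y)
    (F : Y -> V) : uniq s -> v \in s ->
  \sum_(u <- s) (if v == u then F u else 0) = F v.
Proof.
move=> us vs; rewrite (bigD1_seq v)//= eqxx big1 ?addr0// => u.
by rewrite eq_sym => /negPf ->.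
Qed.

(** Expanding in indicators of the fibres of [f] handles an arbitrary [phi]. The list [s] may
    contain values never taken; their fibres are empty. *)
Lemma expectation_step {Y : choiceType} (f : Omega -> Y) (s : seq Y) (phi : Y -> R) :
  step_measurable measurable f -> uniq s -> (forall w, f w \in s) ->
  ('E_P[fun w => phi (f w)] =
    (\sum_(v <- s) phi v * fine (P (f @^-1` [set v])))%:E)%E.
Proof.
move=> [_ mf] us fs; rewrite unlock.
transitivity (\int[P]_w \sum_(v <- s) ((phi v)%:E * (\1_(f @^-1` [set v]) w)%:E))%E.
  apply: eq_integral => w _; rewrite -[in LHS](sum_eq_indicator phi us (fs w)).
  rewrite -sumEFin; apply: eq_bigr => v _; rewrite -EFinM indicE /=.
  by case: eqVneq => [<-|fv]; [rewrite mem_set ?mulr1 | rewrite memNset ?mulr0//; exact/eqP].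
rewrite integral_sum//; last first.
  move=> v; apply: integrableZl => //; exact: integrable_indic.
rewrite -sumEFin; apply: eq_bigr => v _.
rewrite integralZl//; last exact: integrable_indic.
by rewrite integral_indic// setIT EFinM fineK// fin_num_measure.
Qed.

Lemma le_expectation_step {Y : choiceType} (f : Omega -> Y) (phi psi : Y -> R) :
  step_measurable measurable f -> (forall w, phi (f w) <= psi (f w)) ->
  ('E_P[fun w => phi (f w)] <= 'E_P[fun w => psi (f w)])%E.
Proof.
move=> mf le_phipsi; have [s us fs] := finite_range_seq mf.1.
rewrite !(expectation_step _ mf us fs) lee_fin; apply: ler_sum => v _.
(* The comparison of [phi] and [psi] is known only at attained values; the others have weight
   zero. *)
have [[w _ <-]|nfv] := pselect (range f v).
  by rewrite ler_wpM2r// fine_ge0.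
suff -> : f @^-1` [set v] = set0 by rewrite measure0 !mulr0.
by apply/seteqP; split=> // w /= fw; apply: nfv; exists w.
Qed.

Lemma simple_expectationE {X : normedModType R} (A : set Omega) (f : Omega -> X)
    (s : seq X) : uniq s -> (forall w, f w \in s) ->
  simple_expectation P A f =
    \sum_(v <- s) fine (P (A `&` f @^-1` [set v])) *: v.
Proof.
move=> us fs; rewrite /simple_expectation; apply: fsbig_fwiden => //.
  by move=> _ [w _ <-] /=; exact: fs.
move=> v [_ nfv] /=; suff -> : A `&` f @^-1` [set v] = set0 by rewrite measure0 scale0r.
by apply/seteqP; split=> // w /= [_ fw]; apply: nfv; exists w.
Qed.

Lemma measure_step_partition {Y : choiceType} (f : Omega -> Y) (s : seq Y) A :
  step_measurable measurable f -> measurable A -> uniq s -> (forall w, f w \in s) ->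
  \sum_(v <- s) fine (P (A `&` f @^-1` [set v])) = fine (P A).
Proof.
move=> [_ mf] mA us fs.
have mAf v : measurable (A `&` f @^-1` [set v]) by exact: measurableI.
apply: EFin_inj; rewrite fineK ?fin_num_measure// -sumEFin.
transitivity (P (\bigcup_(v in [set` s]) (A `&` f @^-1` [set v]))).
  rewrite measure_fin_bigcup// => [|u v _ _ [w [/= [_ <-] [_ <-]]]] //.
  by rewrite fsbig_seq//; apply: eq_fsbigr => v _; rewrite fineK// fin_num_measure.
congr (P _); apply/seteqP; split=> [w [v _ []] //|w Aw].
by exists (f w) => //=; exact: fs.
Qed.

(* Conditionally on an atom of [k], Jensen's inequality for the norm is the
   triangle inequality for the finite sum defining the expectation. *)
Lemma expectation_norm_condexp {X : normedModType R} {K : choiceType}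
    (G : set (set Omega)) (k : Omega -> K) (f : Omega -> X) (g : K -> X)
    (a b : K -> R) :
  sigma_algebra setT G -> G `<=` measurable -> step_measurable G k ->
  step_measurable measurable f ->
  (forall A, G A -> simple_expectation P A f = simple_expectation P A (g \o k)) ->
  (forall w, 0 <= b (k w)) ->
  ('E_P[fun w => (a (k w) - b (k w) * `|f w|)%R]
     <= 'E_P[fun w => (a (k w) - b (k w) * `|g (k w)|)%R])%E.
Proof.
move=> sG Gm kG mf cond b0.
have mk : step_measurable measurable k by exact: sub_step_measurable kG.
have sm : sigma_algebra setT (@measurable _ Omega).
  by apply: sigma_algebra_measurable.
have [sf usf fsf] := finite_range_seq mf.1.
have [sk usk ksk] := finite_range_seq mk.1.
(* Using the joint values of (k, f), both expectations become sums over the values c of [k],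
   compared term by term. *)
have mkf := step_measurable_pair sm mk mf.
have us : uniq [seq (c, v) | c <- sk, v <- sf].
  by apply: allpairs_uniq => // -[? ?] [? ?] _ _ [-> ->].
rewrite (expectation_step (fun c => a c - b c * `|g c|) mk usk ksk).
rewrite (expectation_step (fun c => a c.1 - b c.1 * `|c.2|) mkf us); last first.
  by move=> w; apply: allpairs_f.
rewrite lee_fin big_allpairs; apply: ler_sum => c _ /=.
pose q v := fine (P (k @^-1` [set c] `&` f @^-1` [set v])).
have -> : \sum_(v <- sf) (a c - b c * `|v|) *
    fine (P ((fun w => (k w, f w)) @^-1` [set (c, v)])) =
    \sum_(v <- sf) (a c - b c * `|v|) * q v.
  apply: eq_bigr => v _; congr (_ * fine (P _)).
  by apply/seteqP; split=> w /= [-> ->].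
(* An unattained [c] contributes zero to both sides; for an attained one the sign of [b c] is
   known. *)
have [[w0 kw0]|] := pselect (exists w, k w = c); last first.
  move=> nkc; suff k0 : k @^-1` [set c] = set0.
    rewrite k0 measure0 mulr0 big1// => v _.
    by rewrite /q k0 set0I measure0 mulr0.
  by apply/seteqP; split=> // w /= kw; apply: nkc; exists w.
have GA : G (k @^-1` [set c]) by apply: kG.2.
have qE : \sum_(v <- sf) q v = fine (P (k @^-1` [set c])).
  by apply: measure_step_partition => //; exact: Gm.
have := cond _ GA; rewrite (simple_expectationE _ usf fsf) => condc.
(* The conditional expectation identity on the atom k = c, where the composite of [g] and [k] is
   constantly [g c]. *)
have condE : \sum_(v <- sf) q v *: v = fine (P (k @^-1` [set c])) *: g c.
  rewrite condc (simple_expectationE _ (undup_uniq (map g sk))); last first.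
    by move=> w; rewrite mem_undup; apply: map_f; exact: ksk.
  rewrite (bigD1_seq (g c)) ?undup_uniq ?mem_undup ?map_f//=; last first.
    by rewrite -kw0; exact: ksk.
  rewrite big1 ?addr0; last first.
    move=> u ugc; suff -> : k @^-1` [set c] `&` (g \o k) @^-1` [set u] = set0.
      by rewrite measure0 scale0r.
    by apply/seteqP; split=> // w /= [-> gu]; move/eqP: ugc; apply.
  by congr (fine (P _) *: _); apply/setIidl => w /= -> .
have q0 v : 0 <= q v by rewrite fine_ge0.
have -> : \sum_(v <- sf) (a c - b c * `|v|) * q v =
    a c * fine (P (k @^-1` [set c])) - b c * \sum_(v <- sf) `|q v *: v|.
  rewrite -qE !mulr_sumr -sumrB; apply: eq_bigr => v _.
  by rewrite normrZ (ger0_norm (q0 v)); ring.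
rewrite mulrBl lerD2l lerN2 -mulrA ler_wpM2l//; first by rewrite -kw0.
rewrite mulrC -[X in X * _]ger0_norm ?fine_ge0// -normrZ -condE.
exact: ler_norm_sum.
Qed.

End Expectation.

(** * The supermartingale argument for the upper bound *)

Section UpperBound.
Context {R : realType} {X : normedModType R} (p : R).
Hypothesis p_gt1 : 1 < p.
Context {d : measure_display} {Omega : measurableType d}.
Variables (P : probability Omega R) (F : nat -> set (set Omega)).
Variables (T : nat) (x : X) (M : nat -> Omega -> X).
Hypothesis martM : simple_martingale P F T x M.

Lemma max_norm0 w : max_norm M 0 w = `|M 0%N w|.
Proof. by rewrite /max_norm /index_iota /= big_cons big_nil max_l. Qed.

Lemma max_normS t w :
  max_norm M t.+1 w = Num.max (max_norm M t w) `|M t.+1 w|.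
Proof.
(* The last term goes into the initial value of the fold, because 0 is not neutral for the maximum
   on [R]. *)
rewrite /max_norm /index_iota !subn0 -(addn1 t.+1) iotaD cats1 big_rcons_op /=.
elim: (0%N :: _) => [|i r IHr]; first by rewrite !big_nil maxC.
by rewrite !big_cons IHr maxA.
Qed.

Lemma max_norm_ge0 t w : 0 <= max_norm M t w.
Proof. by rewrite /max_norm bigmax_idl le_max lexx. Qed.

Lemma filtration_measurable t : F t `<=` measurable.
Proof. by have [[]] := martM. Qed.

Lemma filtration_sigma_algebra t : sigma_algebra setT (F t).
Proof. by have [[]] := martM. Qed.

Lemma step_measurable_martingale t : (t <= T)%N -> step_measurable (F t) (M t).
Proof.
move=> tT; have [_ _ fin bm _] := martM.
apply: step_measurable_fibers; [exact: filtration_sigma_algebra|exact: fin|].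
(* A singleton is Borel: points of a normed space are closed, so its complement is open. *)
move=> v; apply: (bm _ tT); rewrite -(setCK [set v]).
apply: sigma_algebraC; apply: sub_sigma_algebra; apply: closed_openC.
by apply: accessible_closed_set1; exact: hausdorff_accessible.
Qed.

Lemma step_measurable_max_norm t : (t <= T)%N ->
  step_measurable (F t) (max_norm M t).
Proof.
have [[_ _ Fmono] _ _ _ _] := martM.
elim: t => [|t IH] tT.
  have -> : max_norm M 0 = Num.norm \o M 0%N by apply/funext => w; rewrite max_norm0.
  exact/step_measurable_comp/step_measurable_martingale.
have -> : max_norm M t.+1 = (fun z => Num.max z.1 `|z.2|) \o
    (fun w => (max_norm M t w, M t.+1 w)).
  by apply/funext => w; rewrite max_normS.
apply/step_measurable_comp/step_measurable_pair.
- exact: filtration_sigma_algebra.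
- by apply: sub_step_measurable (IH (ltnW tT)); exact: Fmono.
- exact: step_measurable_martingale.
Qed.

Lemma step_measurable_max_norm_pair t : (t <= T)%N ->
  step_measurable (F t) (fun w => (max_norm M t w, M t w)).
Proof.
move=> tT; apply: step_measurable_pair; first exact: filtration_sigma_algebra.
  exact: step_measurable_max_norm.
exact: step_measurable_martingale.
Qed.

Lemma expectation_majorant_le (y : R) t : `|x| <= y -> (t <= T)%N ->
  ('E_P[fun w => doob_majorant p `|M t w| (Num.max (max_norm M t w) y)]
     <= (doob_majorant p `|x| y)%:E)%E.
Proof.
move=> xy; have [_ M0 _ _ condM] := martM.
have y0 : 0 <= y by exact: le_trans xy.
have p1_gt0 : 0 < p - 1 by rewrite subr_gt0.
elim: t => [|t IH] tT.
  under eq_fun do rewrite max_norm0 M0 (max_r xy).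
  by rewrite expectation_cst.
apply: le_trans (IH (ltnW tT)).
(* With the maximum frozen at time t, the majorant is affine in the norm of M_(t+1), with
   coefficients that are functions of [k]. *)
pose k w := (max_norm M t w, M t w).
have Fk : step_measurable (F t) k by exact/step_measurable_max_norm_pair/ltnW.
pose s (z : R * X) := Num.max z.1 y.
pose a z := p * s z `^ p.
pose b z := p ^+ 2 / (p - 1) * s z `^ (p - 1).
have mM : step_measurable measurable (M t.+1).
  apply: sub_step_measurable (step_measurable_martingale tT).
  exact: filtration_measurable.
have mk : step_measurable measurable k.
  exact/(sub_step_measurable _ Fk)/filtration_measurable.
have mkM := step_measurable_pair (sigma_algebra_measurable _) mk mM.
(* Pointwise, [doob_majorant_maxr] removes the new norm from the maximum; conditional Jensen then
   replaces M_(t+1) by M_t. *)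
apply: (@le_trans _ _ 'E_P[fun w => (a (k w) - b (k w) * `|M t.+1 w|)%R])%E.
  pose phi (z : R * X * X) :=
    doob_majorant p `|z.2| (Num.max (Num.max z.1.1 `|z.2|) y).
  pose psi (z : R * X * X) := a z.1 - b z.1 * `|z.2|.
  have : forall w, phi (k w, M t.+1 w) <= psi (k w, M t.+1 w).
    move=> w; rewrite /phi /psi /a /b /s /= maxAC.
    apply: le_trans (doob_majorant_maxr p_gt1 _ _) _ => //.
      by rewrite le_max y0 orbT.
    by rewrite /doob_majorant mulrAC.
  move=> /(le_expectation_step P mkM); rewrite /phi /psi /=.
  by under eq_fun do rewrite -max_normS.
have b0 w : 0 <= b (k w).
  by rewrite /b mulr_ge0 ?powR_ge0// divr_ge0 ?ltW// exprn_gt0// (lt_trans ltr01).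
apply: le_trans (expectation_norm_condexp a (g := snd)
  (filtration_sigma_algebra t) (@filtration_measurable t) Fk mM _ b0) _.
  by move=> A FA; have [_ /(_ _ FA)] := condM t t.+1 (introT andP (conj (leqnSn t) tT)).
rewrite le_eqVlt; apply/orP; left; apply/eqP; congr ('E_P[_]%E).
by apply/funext => w; rewrite /a /b /s /doob_majorant /= mulrAC.
Qed.

Lemma expectation_payoff_le (y : R) : `|x| <= y ->
  ('E_P[fun w => (Num.max (max_norm M T w `^ p) (y `^ p)
                    - (p / (p - 1)) `^ p * `|M T w| `^ p)%R]
     <= (doob_majorant p `|x| y)%:E)%E.
Proof.
move=> xy; have y0 : 0 <= y by exact: le_trans xy.
apply: le_trans (expectation_majorant_le xy (leqnn T)).
have mk := sub_step_measurable (@filtration_measurable T)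
  (step_measurable_max_norm_pair (leqnn T)).
apply: (@le_expectation_step _ _ _ P _ _
  (fun z => Num.max (z.1 `^ p) (y `^ p) - (p / (p - 1)) `^ p * `|z.2| `^ p)
  (fun z => doob_majorant p `|z.2| (Num.max z.1 y)) mk) => w /=.
have -> : Num.max (max_norm M T w `^ p) (y `^ p) = Num.max (max_norm M T w) y `^ p.
  have p0 : 0 <= p by rewrite ltW// (lt_trans ltr01).
  case: (leP (max_norm M T w) y) => h.
    by rewrite max_r// ge0_ler_powR// nnegrE max_norm_ge0.
  by rewrite max_l// ge0_ler_powR// ?nnegrE ?max_norm_ge0// ltW.
by apply: payoff_le_majorant => //; rewrite le_max y0 orbT.
Qed.

End UpperBound.

(** * The upper bound in both regimes and Doob's inequality *)

Lemma expectation_step_lin {R : realType} {d : measure_display}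
    {Omega : measurableType d} (P : probability Omega R) {Y : choiceType}
    (f : Omega -> Y) (phi psi : Y -> R) (c : R) :
  step_measurable measurable f ->
  ('E_P[fun w => (phi (f w) - c * psi (f w))%R] =
     'E_P[fun w => phi (f w)] - c%:E * 'E_P[fun w => psi (f w)])%E.
Proof.
move=> mf; have [s us fs] := finite_range_seq mf.1.
rewrite (expectation_step P (fun v => phi v - c * psi v) mf us fs).
rewrite !(expectation_step P _ mf us fs) -EFinM -EFinB; congr EFin.
by rewrite mulr_sumr -sumrB; apply: eq_bigr => v _; ring.
Qed.

Lemma max_diff_le {R : realDomainType} (a b c : R) :
  b <= c -> Num.max a c <= Num.max a b + (c - b).
Proof.
move=> bc; rewrite ge_max; apply/andP; split.
  by rewrite (le_trans (_ : _ <= Num.max a b)) ?le_max ?lexx// lerDl subr_ge0.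
by rewrite -lerBlDr opprB addrC subrK le_max lexx orbT.
Qed.

Section Consequences.
Context {R : realType} {X : normedModType R} (p : R).
Hypothesis p_gt1 : 1 < p.

Let p_gt0 : 0 < p. Proof. exact: lt_trans ltr01 p_gt1. Qed.
Let p1_gt0 : 0 < p - 1. Proof. by rewrite subr_gt0. Qed.

Lemma doob_majorant_eq0 (m : R) : 0 <= m -> doob_majorant p m (p / (p - 1) * m) = 0.
Proof.
move=> m0; rewrite /doob_majorant.
have q0 : 0 < p / (p - 1) by rewrite divr_gt0.
rewrite -(mulr_powRB1 (mulr_ge0 (ltW q0) m0) p_gt0).
by set A := _ `^ (p - 1); field; rewrite gt_eqF.
Qed.

Lemma doob_bound_is_constant (x : X) (y : R) : `|x| <= y ->
  doob_constant p x y (doob_bound p x y).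
Proof.
move=> xy d Omega P F T M martM; rewrite /doob_bound.
case: ifPn => [xlt|_]; last exact: (expectation_payoff_le p_gt1 martM xy).
(* Below the threshold, start from y' = c |x|, where the majorant vanishes. Raising y' to y
   increases the payoff by at most y^p - y'^p, which is the claimed bound because y'^p = c^p
   |x|^p. *)
pose y' := p / (p - 1) * `|x|.
have xy' : `|x| <= y'.
  by rewrite ler_peMl// ler_pdivlMr// mul1r lerBlDr lerDl.
have y'0 : 0 <= y' by exact: le_trans xy'.
have y'y : y' <= y.
  rewrite ltW//; move: xlt; rewrite -(ltr_pM2l (_ : 0 < p / (p - 1))) ?divr_gt0//.
  by rewrite mulrA (_ : p / (p - 1) * ((p - 1) / p) = 1) ?mul1r//; field; rewrite !gt_eqF.
have mk := sub_step_measurable (filtration_measurable martM (t := T))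
  (step_measurable_max_norm_pair martM (leqnn T)).
set c := (p / (p - 1)) `^ p.
pose phi y (z : R * X) := Num.max (z.1 `^ p) (y `^ p) - c * `|z.2| `^ p.
pose K := y `^ p - y' `^ p.
have le1 : forall w, phi y (max_norm M T w, M T w) <=
    phi y' (max_norm M T w, M T w) - (- K) * 1.
  move=> w; rewrite mulr1 opprK /phi /= addrAC lerD2r; apply: max_diff_le.
  by rewrite ge0_ler_powR ?nnegrE ?(ltW p_gt0)// (le_trans y'0).
have := le_expectation_step P (psi := fun z => phi y' z - (- K) * 1) mk le1.
rewrite /phi /= => /le_trans; apply.
rewrite (expectation_step_lin P (phi y') (fun=> 1) _ mk) expectation_cst mule1.
have := expectation_payoff_le p_gt1 martM xy'.
rewrite doob_majorant_eq0// => le0.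
rewrite EFinN oppeK (_ : _ - c * _ = K); last first.
  rewrite /K /y' powRM ?divr_ge0 ?(ltW p_gt0)// ltW//.
by rewrite -[leRHS]add0e leeD2r.
Qed.

(** The case y = |x|: since M_0 = x, the running maximum is at least |x| and y drops out of the
    payoff, while u(|x|, |x|) = -c |x|^p. *)
Lemma doob_inequality (x : X) (d : measure_display) (Omega : measurableType d)
    (P : probability Omega R) (F : nat -> set (set Omega))
    (T : nat) (M : nat -> Omega -> X) : simple_martingale P F T x M ->
  ('E_P[fun w => (max_norm M T w `^ p - (p / (p - 1)) `^ p * `|M T w| `^ p)%R]
     <= (- (p / (p - 1) * `|x| `^ p))%:E)%E.
Proof.
move=> martM; have [_ M0 _ _ _] := martM.
have := expectation_payoff_le p_gt1 martM (lexx `|x|).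
rewrite /doob_majorant -[_ * `|x| * _]mulrA mulr_powRB1//.
rewrite (_ : p * `|x| `^ p - _ = - (p / (p - 1) * `|x| `^ p)); last first.
  by field; rewrite gt_eqF.
apply: le_trans; rewrite le_eqVlt; apply/orP; left; apply/eqP; congr ('E_P[_]%E).
apply/funext => w; rewrite max_l// ge0_ler_powR ?nnegrE ?max_norm_ge0 ?(ltW p_gt0)//.
rewrite -(M0 w); apply: (@le_bigmax_seq _ _ _ _ _ 0%N xpredT (fun t => `|M t w|)) => //.
Qed.

Lemma doob_Lnorm_inequality (x : X) (d : measure_display) (Omega : measurableType d)
    (P : probability Omega R) (F : nat -> set (set Omega))
    (T : nat) (M : nat -> Omega -> X) : simple_martingale P F T x M ->
  (Lnorm P p%:E (fun w => (max_norm M T w)%:E)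
     <= (p / (p - 1))%:E * Lnorm P p%:E (fun w => `|M T w|%:E))%E.
Proof.
move=> martM; have c0 : 0 <= p / (p - 1) by rewrite divr_ge0// ltW.
have mk := sub_step_measurable (filtration_measurable martM (t := T))
  (step_measurable_max_norm_pair martM (leqnn T)).
have LE (f : Omega -> R) : (forall w, 0 <= f w) ->
    (Lnorm P p%:E (fun w => (f w)%:E) = 'E_P[fun w => (f w `^ p)%R] `^ p^-1)%E.
  move=> f0; rewrite !unlock; congr (_ `^ _)%E.
  by apply: eq_integral => w _; rewrite /= ger0_norm.
rewrite LE => [|w]; last exact: max_norm_ge0.
rewrite LE => [|w]; last exact: normr_ge0.
have le0 : - (p / (p - 1) * `|x| `^ p) <= 0 by rewrite oppr_le0 mulr_ge0 ?powR_ge0.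
have := le_trans (doob_inequality martM) (_ : (_ <= 0)%E); rewrite lee_fin => /(_ le0).
(* Finite range makes both expectations real numbers, so the inequality splits into A <= c^p B, and
   p-th roots can be taken. *)
rewrite (expectation_step_lin P (fun z => z.1 `^ p) (fun z => `|z.2| `^ p) _ mk) /=.
have [s us ks] := finite_range_seq mk.1.
have := expectation_step P (fun z => z.1 `^ p) mk us ks => /= E1.
have := expectation_step P (fun z => `|z.2| `^ p) mk us ks => /= E2.
have A0 : (0 <= 'E_P[fun w => (max_norm M T w `^ p)%R])%E.
  by apply: expectation_ge0 => w; exact: powR_ge0.
have B0 : (0 <= 'E_P[fun w => (`|M T w| `^ p)%R])%E.
  by apply: expectation_ge0 => w; exact: powR_ge0.
move: A0 B0; rewrite E1 E2; set A := \sum_(v <- _) _; set B := \sum_(v <- _) _.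
rewrite !lee_fin => A0 B0; rewrite subr_le0 => AB.
have -> : p / (p - 1) = ((p / (p - 1)) `^ p) `^ p^-1.
  by rewrite -powRrM mulfV ?powRr1// gt_eqF.
rewrite -powRM ?powR_ge0//.
by rewrite ge0_ler_powR ?nnegrE ?mulr_ge0 ?powR_ge0 ?invr_ge0// ltW.
Qed.

End Consequences.

(** * Finitely supported probabilities on the natural numbers *)

Section Discrete.
Context {R : realType}.
Variables (n : nat) (w : nat -> R).
Hypotheses (w_ge0 : forall k, 0 <= w k) (w_sum : \sum_(0 <= k < n) w k = 1).

Lemma discrete_probability_exists : exists P : probability nat R,
  forall A, fine (P A) = \sum_(0 <= k < n) w k * (k \in A)%:R.
Proof.
pose m : {measure set nat -> \bar R} :=
    msum (fun k => mscale (NngNum (w_ge0 k)) (\d_k : measure nat R)) n.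
have mE A : m A = (\sum_(0 <= k < n) w k * (k \in A)%:R)%:E.
  rewrite /m /= /msum /= -sumEFin big_mkord; apply: eq_bigr => k _.
  by rewrite /mscale /= diracE EFinM.
have m1 : m [set: nat] = 1%E.
  rewrite mE -[in RHS]w_sum; congr EFin; apply: eq_bigr => k _; rewrite mem_set ?mulr1//.
pose P : probability nat R := HB.pack (Measure.sort m)
  (Measure_isProbability.Build _ _ _ m m1).
by exists P => A; rewrite -[P A]/(m A) mE.
Qed.

Variable P : probability nat R.
Hypothesis PE : forall A, fine (P A) = \sum_(0 <= k < n) w k * (k \in A)%:R.

Lemma expectation_discrete {Y : choiceType} (f : nat -> Y) (phi : Y -> R) :
  finite_set (range f) ->
  ('E_P[fun i => phi (f i)] = (\sum_(0 <= k < n) w k * phi (f k))%:E)%E.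
Proof.
move=> finf; have [s us fs] := finite_range_seq finf.
rewrite (expectation_step P phi (conj finf (fun=> I)) us fs); congr EFin.
under eq_bigr => v _ do rewrite PE mulr_sumr.
rewrite exchange_big /=; apply: eq_bigr => k _.
rewrite -[in RHS](sum_eq_indicator phi us (fs k)) mulr_sumr; apply: eq_bigr => v _.
case: eqVneq => [<-|fv]; first by rewrite mem_set// mulr1 mulrC.
by rewrite memNset ?mulr0//; exact/eqP.
Qed.

Lemma simple_expectation_discrete {X : normedModType R} (A : set nat) (f : nat -> X) :
  finite_set (range f) ->
  simple_expectation P A f = \sum_(0 <= k < n) (w k * (k \in A)%:R) *: f k.
Proof.
move=> finf; have [s us fs] := finite_range_seq finf.
rewrite (simple_expectationE _ _ us fs).
under eq_bigr => v _ do rewrite PE scaler_suml.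
rewrite exchange_big /=; apply: eq_bigr => k _.
rewrite -[in RHS](sum_eq_indicator id us (fs k)) scaler_sumr; apply: eq_bigr => v _.
rewrite in_setI; case: eqVneq => [<-|fv].
  by rewrite [X in _ && X]mem_set// andbT.
by rewrite [X in _ && X]memNset ?andbF ?mulr0 ?scale0r ?scaler0//; exact/eqP.
Qed.

End Discrete.

(** * Ladder martingales on a ray *)

(* The ladder climbs through [s 0, s 1, ...] and, when it fails to climb from
   [s k], stops forever at [l k]; the sample point is the number of climbs and
   [Q k] is the probability of at least [k] climbs. *)
Section Ladder.
Context {R : realType} {X : normedModType R}.
Variables (e : X) (s l Q : nat -> R) (N : nat).
Hypotheses (Q0 : Q 0%N = 1) (Q_ge0 : forall k, 0 <= Q k).
Hypothesis Q_le : forall k, Q k.+1 <= Q k.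
Hypothesis balance : forall k,
  Q k * s k = Q k.+1 * s k.+1 + (Q k - Q k.+1) * l k.

Definition ladder_position t k : R := if (t <= k)%N then s t else l k.

Definition ladder t k : X := ladder_position t k *: e.

(** The ladder is cut off after [N] climbs, so the sample point [N] carries the whole tail [Q N]. *)
Definition ladder_weight k : R := if (k < N)%N then Q k - Q k.+1 else Q k.

(** At time t only min(k, t) is known, so an event cannot separate sample points from t on. *)
Definition ladder_filtration t : set (set nat) :=
  [set A | forall i, (t <= i)%N -> A i <-> A t].

Lemma ladder_weight_ge0 k : 0 <= ladder_weight k.
Proof. by rewrite /ladder_weight; case: ifP; rewrite ?subr_ge0. Qed.

Lemma ladder_weight_tail t : (t <= N)%N ->
  \sum_(t <= k < N.+1) ladder_weight k = Q t.
Proof.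
move=> tN; rewrite big_nat_recr//= {2}/ladder_weight ltnn.
rewrite (eq_big_nat _ _ (F2 := fun k => Q k - Q k.+1)); last first.
  by move=> k /andP[_ kN]; rewrite /ladder_weight kN.
by rewrite (telescope_sumr_eq (fun k => - Q k))// => [|k _]; ring.
Qed.

Lemma finite_range_ladder t : finite_set (range (ladder t)).
Proof.
apply: (@sub_finite_set _ _ (ladder t @` `I_t.+1)); last exact: finite_image.
move=> _ [k _ <-]; exists (minn k t) => /=; first by rewrite ltnS geq_minr.
rewrite /ladder /ladder_position leq_min leqnn andbT.
by case: leqP => // /ltnW kt; rewrite (minn_idPl kt).
Qed.

Lemma ladder_filtrationP : filtration ladder_filtration.
Proof.
split=> [t|//|u t ut A FA i ti].
  split=> [//|A FA i ti|A FA i ti] /=.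
    by rewrite /setD /= FA.
  by split=> -[k _ Ak]; exists k => //; apply/(FA k i ti).
exact: iff_trans (FA i (leq_trans ut ti)) (iff_sym (FA t ut)).
Qed.

(** Sample points k < t have stopped and do not move. The event contains all k >= t or none, so the
    remaining increment is its indicator at t times the drift of one step, which [balance] makes
    zero. *)
Lemma ladder_step A t : (t < N)%N -> ladder_filtration t A ->
  \sum_(0 <= k < N.+1) (ladder_weight k * (k \in A)%:R) *: ladder t.+1 k =
  \sum_(0 <= k < N.+1) (ladder_weight k * (k \in A)%:R) *: ladder t k.
Proof.
move=> tN FA; apply/eqP; rewrite -subr_eq0 -sumrB; apply/eqP.
under eq_bigr => k _ do rewrite /ladder -scalerBr -scalerBl scalerA.
rewrite -scaler_suml (_ : \sum_(0 <= k < N.+1) _ = 0) ?scale0r//.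
rewrite (big_cat_nat (n := t))//= ?(leq_trans (ltnW tN))//.
rewrite big_nat big1 ?add0r; last first.
  move=> k /andP[_ kt]; rewrite /ladder_position leqNgt (ltn_trans kt)//=.
  by rewrite leqNgt kt /= subrr mulr0.
rewrite big_ltn ?ltnS ?(ltnW tN)//.
have -> : \sum_(t.+1 <= k < N.+1)
    ladder_weight k * (k \in A)%:R * (ladder_position t.+1 k - ladder_position t k) =
    (t \in A)%:R * (s t.+1 - s t) * \sum_(t.+1 <= k < N.+1) ladder_weight k.
  rewrite mulr_sumr; apply: eq_big_nat => k /andP[tk _].
  rewrite /ladder_position tk (ltnW tk) (_ : (k \in A) = (t \in A)); first by ring.
  by apply/idP/idP; rewrite !inE => /(FA k (ltnW tk)).
rewrite ladder_weight_tail// /ladder_position ltnn leqnn /ladder_weight tN.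
have := balance t; set a := (t \in A)%:R => b.
transitivity (a * (Q t.+1 * s t.+1 + (Q t - Q t.+1) * l t - Q t * s t)); first by ring.
by rewrite -b subrr mulr0.
Qed.

Lemma simple_martingale_ladder (P : probability nat R) :
  (forall A, fine (P A) = \sum_(0 <= k < N.+1) ladder_weight k * (k \in A)%:R) ->
  simple_martingale P ladder_filtration N (s 0%N *: e) ladder.
Proof.
move=> PE.
have bm t : borel_measurable (ladder_filtration t) (ladder t).
  by move=> B _ i ti /=; rewrite /ladder /ladder_position ti leqnn.
split=> //.
- exact: ladder_filtrationP.
- by move=> t _; exact: finite_range_ladder.
move=> u t /andP[ut tN]; split=> // A FA.
rewrite !(simple_expectation_discrete PE)//; try exact: finite_range_ladder.
(* One-step identities are chained from u to t, an event at time u being an event at every later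
   time. *)
elim: t ut tN => [|t IH]; first by rewrite leqn0 => /eqP ->.
rewrite leq_eqVlt => /predU1P[-> //|ut] tN.
rewrite -IH ?(ltnW tN)//; apply: ladder_step => //.
by have [_ _ Fmono] := ladder_filtrationP; exact: (Fmono _ _ _ _ FA).
Qed.

(** A path with k climbs has maximum at least [s k]; it ends at [l k] if k < N and at [s N] if k =
    N. *)
Lemma doob_constant_ladder (p y C : R) : `|e| = 1 -> 0 < p -> 0 <= y ->
  (forall k, 0 <= s k) -> (forall k, 0 <= l k) ->
  doob_constant p (s 0%N *: e) y C ->
  \sum_(0 <= k < N) (Q k - Q k.+1) *
      (Num.max (s k `^ p) (y `^ p) - (p / (p - 1)) `^ p * l k `^ p)
    + Q N * (Num.max (s N `^ p) (y `^ p) - (p / (p - 1)) `^ p * s N `^ p) <= C.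
Proof.
move=> e1 p0 y0 s0 l0 hC.
have wsum : \sum_(0 <= k < N.+1) ladder_weight k = 1.
  by rewrite ladder_weight_tail.
have [P PE] := discrete_probability_exists ladder_weight_ge0 wsum.
have mart := simple_martingale_ladder PE.
have := hC _ _ _ _ _ _ mart.
set c := (p / (p - 1)) `^ p.
have mk := step_measurable_max_norm_pair mart (leqnn N).
rewrite (expectation_discrete PE (f := fun w => (max_norm ladder N w, ladder N w))
  (fun z => Num.max (z.1 `^ p) (y `^ p) - c * `|z.2| `^ p) mk.1) lee_fin.
apply: le_trans; rewrite big_nat_recr//= /ladder_weight ltnn.
have norm_ladder t k : `|ladder t k| = ladder_position t k.
  rewrite normrZ e1 mulr1 ger0_norm// /ladder_position; by case: ifP.
have maxs k : (k <= N)%N -> s k <= max_norm ladder N k.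
  move=> kN; have -> : s k = `|ladder k k| by rewrite norm_ladder /ladder_position leqnn.
  apply: (@le_bigmax_seq _ _ _ _ _ k xpredT (fun t => `|ladder t k|)) => //.
  by rewrite mem_index_iota.
have maxp k : (k <= N)%N ->
    Num.max (s k `^ p) (y `^ p) <= Num.max (max_norm ladder N k `^ p) (y `^ p).
  move=> kN; rewrite ge_max [in X in _ && X]le_max lexx orbT andbT le_max.
  by rewrite ge0_ler_powR ?nnegrE ?(ltW p0) ?max_norm_ge0 ?maxs.
apply: lerD.
  apply: ler_sum_nat => k /andP[_ kN]; rewrite kN ler_wpM2l ?subr_ge0//.
  by rewrite norm_ladder /ladder_position leqNgt kN /= lerD2r maxp// ltnW.
by rewrite ler_wpM2l// norm_ladder /ladder_position leqnn lerD2r maxp.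
Qed.

End Ladder.

(** * Lower bounds from ladders with geometric levels *)

Section LowerBound.
Context {R : realType} {X : normedModType R} (p : R).
Hypothesis p_gt1 : 1 < p.

Let p_gt0 : 0 < p. Proof. exact: lt_trans ltr01 p_gt1. Qed.
Let p1_gt0 : 0 < p - 1. Proof. by rewrite subr_gt0. Qed.

Lemma powR_exprn (r : R) k : 0 <= r -> (r ^+ k) `^ p = (r `^ p) ^+ k.
Proof.
move=> r0; elim: k => [|k IH]; first by rewrite !expr0 powR1.
by rewrite !exprS powRM ?exprn_ge0// IH.
Qed.

(** The martingale property forces the probability [q] of moving from |x| up to y rather than down
    to a y, and the probability (1 - a) / (r - a) of moving from s up to r s rather than down to a
    s. Stopping at a s under maximum s pays s^p b, and these payoffs form a geometric series. *)
Lemma doob_constant_geometric_ladder (x : X) (y C a r q b : R) :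
  0 < `|x| -> `|x| <= y -> 0 < a -> a < 1 -> 1 < r -> a * y <= `|x| ->
  (1 - a) / (r - a) * r `^ p < 1 -> doob_constant p x y C ->
  q = (`|x| - a * y) / (y - a * y) -> b = 1 - (p / (p - 1) * a) `^ p ->
  (1 - q) * y `^ p * b
    + q * y `^ p * ((r - 1) / (r - a - (1 - a) * r `^ p) * b) <= C.
Proof.
move=> x0 xy a0 a1 r1 ayx rho1 hC qE bE.
have y0 : 0 < y by exact: lt_le_trans xy.
have r0 : 0 < r by exact: lt_trans r1.
have ra0 : 0 < r - a by rewrite subr_gt0 (lt_trans a1).
have a1' : 0 < 1 - a by rewrite subr_gt0.
have ya0 : 0 < y - a * y by rewrite -{1}[y]mul1r -mulrBl mulr_gt0.
have q0 : 0 <= q by rewrite qE divr_ge0 ?subr_ge0// -subr_ge0 ltW.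
have q1 : q <= 1 by rewrite qE ler_pdivrMr// mul1r lerD2r.
pose u := (1 - a) / (r - a).
have u0 : 0 <= u by rewrite divr_ge0// ltW.
have u1 : u <= 1 by rewrite ler_pdivrMr// mul1r lerD2r ltW.
set rho := u * r `^ p.
have rho0 : 0 <= rho by rewrite mulr_ge0 ?powR_ge0.
(* The first climb leads to y, and geometric growth starts only there; the shift [k.-1] below makes
   the first two possible stops both a y. *)
pose s k := if k is k'.+1 then y * r ^+ k' else `|x|.
pose l k := a * (y * r ^+ k.-1).
pose Q k := if k is k'.+1 then q * u ^+ k' else 1.
have s0 k : 0 <= s k by case: k => [|k] /=; rewrite ?mulr_ge0 ?exprn_ge0// ltW.
have l0 k : 0 <= l k by rewrite !mulr_ge0 ?exprn_ge0// ltW.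
have Q0 k : 0 <= Q k by case: k => [|k] //=; rewrite mulr_ge0 ?exprn_ge0.
have Qle k : Q k.+1 <= Q k.
  case: k => [|k] /=; first by rewrite expr0 mulr1.
  by rewrite exprS ler_wpM2l// ler_piMl// exprn_ge0.
have bal k : Q k * s k = Q k.+1 * s k.+1 + (Q k - Q k.+1) * l k.
  case: k => [|k] /=.
    by rewrite /l /= !expr0 qE; field; rewrite gt_eqF.
  by rewrite /l /= !exprS /u; field; rewrite gt_eqF.
pose e := `|x|^-1 *: x.
have e1 : `|e| = 1 by rewrite normrZ normfV normr_id mulVf// gt_eqF.
have se : s 0%N *: e = x by rewrite /= scalerA mulfV ?scale1r// gt_eqF.
have hC' : doob_constant p (s 0%N *: e) y C by rewrite se.
have [c cE c0] : exists2 c, c = p / (p - 1) & 0 < c.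
  by exists (p / (p - 1)) => //; rewrite divr_gt0.
rewrite -cE in bE.
(* A lower bound for the expected payoff after n + 1 possible climbs. The last term comes from the
   paths that never stop, which end at their maximum; it vanishes in the limit because rho < 1. *)
pose f n := (1 - q) * y `^ p * b + q * y `^ p * (
  series (geometric ((1 - u) * b) rho) n + geometric (1 - c `^ p) rho n).
have fC n : f n <= C.
  have := @doob_constant_ladder _ _ e s l Q n.+1 erefl Q0 Qle bal p y C e1
    p_gt0 (ltW y0) s0 l0 hC'.
  apply: le_trans; rewrite big_nat_recl//= -cE /f -addrA.
  have powl k : c `^ p * l k `^ p = (c * a) `^ p * (y `^ p * (r `^ p) ^+ k.-1).
    rewrite /l !powRM ?mulr_ge0 ?exprn_ge0 ?(ltW r0) ?(ltW a0) ?(ltW c0) ?(ltW y0)//.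
    by rewrite powR_exprn ?(ltW r0)// mulrA.
  have pows k : s k.+1 `^ p = y `^ p * (r `^ p) ^+ k.
    by rewrite /= powRM ?exprn_ge0 ?(ltW r0) ?(ltW y0)// powR_exprn// ltW.
  apply: lerD.
    rewrite expr0 mulr1 powl /= expr0 mulr1 -mulrA ler_wpM2l ?subr_ge0//.
    by rewrite bE mulrBr mulr1 mulrC lerD2r le_max lexx orbT.
  rewrite mulrDr; apply: lerD.
    rewrite /series /= mulr_sumr; apply: ler_sum => k _.
    rewrite powl /= -(pows k).
    rewrite (_ : q * _ - q * _ = q * u ^+ k * (1 - u)); last by rewrite exprS; ring.
    apply: (@le_trans _ _ (q * u ^+ k * (1 - u) * (s k.+1 `^ p * b))).
      rewrite /rho exprMn pows le_eqVlt; apply/orP; left; apply/eqP; ring.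
    rewrite ler_wpM2l ?mulr_ge0 ?exprn_ge0 ?subr_ge0//.
    by rewrite bE mulrBr mulr1 mulrC lerD2r le_max lexx.
  apply: (@le_trans _ _ (q * u ^+ n * (s n.+1 `^ p * (1 - c `^ p)))).
    rewrite /= /geometric /= /rho exprMn -/(s n.+1) pows le_eqVlt.
    by apply/orP; left; apply/eqP; ring.
  rewrite ler_wpM2l ?mulr_ge0 ?exprn_ge0//.
  by rewrite mulrBr mulr1 [X in _ - X]mulrC lerD2r le_max lexx.
have rho_lt1 : `|rho| < 1 by rewrite ger0_norm.
have fl : f n @[n --> \oo] --> (1 - q) * y `^ p * b
    + q * y `^ p * ((1 - u) * b * (1 - rho)^-1 + 0).
  apply: cvgD; first exact: cvg_cst.
  apply: cvgMr; apply: cvgD; first exact: cvg_geometric_series.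
  exact: cvg_geometric.
rewrite (_ : _ * b + _ = lim (f n @[n --> \oo])); last first.
  rewrite (cvg_lim _ fl)// addr0; congr (_ + _ * _).
  have E2 : 1 - rho = (r - a - (1 - a) * r `^ p) / (r - a).
    by rewrite /rho /u; field; rewrite gt_eqF.
  have E1 : 1 - u = (r - 1) / (r - a) by rewrite /u; field; rewrite gt_eqF.
  rewrite E2 E1 invf_div; set z := (r - a - _)^-1.
  by field; rewrite gt_eqF.
apply: limr_le; first by apply/cvg_ex; eexists; exact: fl.
by near=> n; exact: fC.
Unshelve. all: by end_near. Qed.

End LowerBound.

(** * Choice of the ladder parameters and passage to the limit *)

Section Optimality.
Context {R : realType} {X : normedModType R} (p : R).
Hypothesis p_gt1 : 1 < p.

Let p_gt0 : 0 < p. Proof. exact: lt_trans ltr01 p_gt1. Qed.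
Let p1_gt0 : 0 < p - 1. Proof. by rewrite subr_gt0. Qed.

(** By convexity the tangent to z^p at z = s lies below z^p at z = 1; this is Young's inequality
    with m = 1. *)
Lemma powR_sub1_le (s : R) : 0 <= s -> s `^ p - 1 <= p * s `^ (p - 1) * (s - 1).
Proof.
move=> s0; have := young_powR p_gt1 (@ler01 R) s0.
by rewrite -(mulr_powRB1 s0 p_gt0) powR1; lra.
Qed.

(** With a = (1 + h) / c and [r] depending on [h], a single limit remains. The factor b is at least
    -p w h and its coefficient (r - 1) / D is at most 1 / (h (p - 1 - h)), so h cancels in the
    product. *)
Lemma doob_constant_delta (x : X) (y C h w a q : R) :
  0 < `|x| -> `|x| <= y -> 0 < h -> (p - 1) * h < 1 -> h < p - 1 ->
  a * y <= `|x| -> doob_constant p x y C ->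
  w = (1 + h) `^ (p - 1) -> a = (1 + h) * ((p - 1) / p) ->
  q = (`|x| - a * y) / (y - a * y) ->
  - ((1 - q) * y `^ p * (p * w * h) + q * y `^ p * (p * w / (p - 1 - h))) <= C.
Proof.
move=> x0 xy h0 hp hp1 ayx hC wE aE qE.
have y0 : 0 < y by exact: lt_le_trans xy.
have h1 : 0 <= 1 + h by rewrite addr_ge0// ltW.
have a0 : 0 < a by rewrite aE mulr_gt0 ?divr_gt0// ltr_wpDl.
have a1E : 1 - a = (1 - (p - 1) * h) / p by rewrite aE; field; rewrite gt_eqF.
have a1 : a < 1 by rewrite -subr_gt0 a1E divr_gt0// subr_gt0.
have ya0 : 0 < y - a * y by rewrite -{1}[y]mul1r -mulrBl mulr_gt0// subr_gt0.
have q0 : 0 <= q by rewrite qE divr_ge0 ?subr_ge0// -subr_ge0 ltW.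
have q1 : q <= 1 by rewrite qE ler_pdivrMr// mul1r lerD2r.
have w0 : 0 <= w by rewrite wE powR_ge0.
(* This choice yields D >= (r - 1) (1 - (1 - (p - 1) h) (1 + h^2)), whose last factor is h (p - 1 -
   h) + (p - 1) h^3: the excess h^2 is of smaller order than the gain (p - 1) h. *)
have [r r1 rE] : exists2 r, 1 < r & r `^ (p - 1) = 1 + h ^+ 2.
  exists ((1 + h ^+ 2) `^ (p - 1)^-1); last first.
    by rewrite -powRrM mulVf ?powRr1// ?gt_eqF// addr_ge0// sqr_ge0.
  have h21 : 1 < 1 + h ^+ 2 by rewrite ltrDl exprn_gt0.
  rewrite -[ltLHS](_ : 1 `^ (p - 1)^-1 = 1); last by rewrite powR1.
  by rewrite gt0_ltr_powR ?invr_gt0// ?nnegrE ?ler01// ltW// (lt_trans ltr01).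
have r0 : 0 < r by exact: lt_trans r1.
set D := r - a - (1 - a) * r `^ p.
have DE : (r - 1) * (h * (p - 1 - h)) <= D.
  have := powR_sub1_le (ltW r0); rewrite rE => rp.
  have : (1 - a) * (r `^ p - 1) <= (1 - a) * (p * (1 + h ^+ 2) * (r - 1)).
    by rewrite ler_wpM2l// subr_ge0 ltW.
  rewrite {2}a1E.
  rewrite (_ : (1 - (p - 1) * h) / p * (p * (1 + h ^+ 2) * (r - 1)) =
    (1 - (p - 1) * h) * (1 + h ^+ 2) * (r - 1)); last by field; rewrite gt_eqF.
  have : 0 <= (r - 1) * ((p - 1) * h ^+ 3).
    by rewrite !mulr_ge0 ?exprn_ge0// ?subr_ge0 ltW.
  rewrite /D; lra.
have hh0 : 0 < h * (p - 1 - h) by rewrite mulr_gt0// subr_gt0.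
have r10 : 0 < r - 1 by rewrite subr_gt0.
have D0 : 0 < D by apply: lt_le_trans DE; rewrite mulr_gt0.
(* The ratio of the geometric series is below 1 because D > 0. *)
have rho1 : (1 - a) / (r - a) * r `^ p < 1.
  have ra0 : 0 < r - a by rewrite subr_gt0 (lt_trans a1).
  by rewrite mulrAC ltr_pdivrMr// mul1r -subr_gt0.
have caE : p / (p - 1) * a = 1 + h by rewrite aE; field; rewrite !gt_eqF.
have := doob_constant_geometric_ladder p_gt1 x0 xy a0 a1 r1 ayx rho1 hC qE erefl.
rewrite caE -/D; set b := 1 - _ `^ p.
have bE : - (p * w * h) <= b.
  by have := powR_sub1_le h1; rewrite -wE /b; lra.
apply: le_trans; rewrite opprD; apply: lerD.
  by rewrite -mulrN ler_wpM2l// mulr_ge0 ?powR_ge0 ?subr_ge0.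
rewrite -mulrN ler_wpM2l ?mulr_ge0 ?powR_ge0//.
apply: (@le_trans _ _ ((r - 1) / D * - (p * w * h))); last first.
  by rewrite ler_wpM2l// divr_ge0// ltW.
rewrite mulrN lerN2 mulrAC ler_pdivrMr//.
rewrite (_ : (r - 1) * (p * w * h) =
  p * w / (p - 1 - h) * ((r - 1) * (h * (p - 1 - h)))); last first.
  by field; rewrite gt_eqF// subr_gt0.
by rewrite ler_wpM2l// divr_ge0 ?mulr_ge0 ?(ltW p_gt0)// subr_ge0 ltW.
Qed.

(** As h decreases to 0 in [doob_constant_delta], the first term vanishes and the second tends to
    -(p / (p - 1)) q y^p with q = (|x| - y / c) / (y / p). *)
Lemma doob_bound_minimal_above (x : X) (y C : R) :
  (p - 1) / p * y < `|x| -> `|x| <= y -> doob_constant p x y C ->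
  p * y `^ p - p ^+ 2 / (p - 1) * `|x| * y `^ (p - 1) <= C.
Proof.
move=> yx xy hC.
have y0 : 0 <= y by exact: le_trans xy.
have x0 : 0 < `|x|.
  by apply: le_lt_trans yx; rewrite mulr_ge0// divr_ge0// ltW.
have {}y0 : 0 < y by exact: lt_le_trans xy.
pose a h : R := (1 + h) * ((p - 1) / p).
pose q h : R := (`|x| - a h * y) / (y - a h * y).
pose w h : R := (1 + h) `^ (p - 1).
pose g h := - ((1 - q h) * y `^ p * (p * w h * h)
                + q h * y `^ p * (p * w h / (p - 1 - h))).
have id0 : h @[h --> (0:R)^'+] --> (0 : R).
  exact: cvg_at_right_filter.
have s0 : 1 + h @[h --> (0:R)^'+] --> (1 : R).
  by rewrite -[X in _ --> X]addr0; apply: cvgD => //; exact: cvg_cst.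
have a0 : a h @[h --> (0:R)^'+] --> (p - 1) / p.
  by rewrite -[X in _ --> X]mul1r; apply: cvgMl.
have ay0 : a h * y @[h --> (0:R)^'+] --> (p - 1) / p * y by apply: cvgMl.
have yay : y - (p - 1) / p * y = y / p by field; rewrite gt_eqF.
pose ql := (`|x| - (p - 1) / p * y) / (y / p).
have q0 : q h @[h --> (0:R)^'+] --> ql.
  apply: cvgM; first by apply: cvgB => //; exact: cvg_cst.
  apply: cvgV; first by rewrite gt_eqF// divr_gt0.
  by rewrite -yay; apply: cvgB => //; exact: cvg_cst.
have w0 : w h @[h --> (0:R)^'+] --> (1 : R).
  have c1 : {for 1, continuous (fun z : R => z `^ (p - 1))}.
    apply: differentiable_continuous; apply/derivable1_diffP.
    by apply: derivable_powR; rewrite in_itv/= ltr01.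
  by have := @continuous_cvg _ _ _ _ _ _ _ _ c1 s0; rewrite powR1; apply.
have gl : g h @[h --> (0:R)^'+] --> - ((1 - ql) * y `^ p * (p * 1 * 0)
    + ql * y `^ p * (p * 1 / (p - 1 - 0))).
  apply: cvgN; apply: cvgD.
    apply: cvgM; last by apply: cvgM => //; apply: cvgMr.
    by apply: cvgMl; apply: cvgB => //; exact: cvg_cst.
  apply: cvgM; first exact: cvgMl.
  apply: cvgM; first exact: cvgMr.
  apply: cvgV; first by rewrite subr0 gt_eqF.
  by apply: cvgB => //; exact: cvg_cst.
rewrite (_ : p * _ - _ = lim (g h @[h --> (0:R)^'+])); last first.
  rewrite (cvg_lim _ gl)// !(mulr0, mulr1, subr0, add0r) /ql.
  rewrite -(mulr_powRB1 (ltW y0) p_gt0).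
  by set z := y `^ (p - 1); field; rewrite !gt_eqF.
apply: limr_le; first by apply/cvg_ex; eexists; exact: gl.
near=> h.
have h0 : 0 < h by near: h; exact: nbhs_right_gt.
apply: (@doob_constant_delta x y C h (w h) (a h) (q h)) => //.
- rewrite mulrC -ltr_pdivlMr//; near: h; apply: nbhs_right_lt.
  by rewrite div1r invr_gt0.
(* The strict inequality y / c < |x| leaves room for a y <= |x| when h is small. *)
- rewrite ltW//; near: h.
  by apply: (cvgr_lt _ ay0).
Unshelve. all: by end_near. Qed.

(** The constant martingale on a one-point space, at horizon 0, where y dominates the maximum
    |x|. *)
Lemma doob_constant_payoff0 (x : X) (y C : R) : 0 <= y -> `|x| <= y ->
  doob_constant p x y C -> y `^ p - (p / (p - 1)) `^ p * `|x| `^ p <= C.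
Proof.
move=> y0 xy hC.
pose M (t : nat) (i : unit) := x.
have mart : simple_martingale (\d_tt : probability unit R) (fun=> setT) 0 x M.
  split=> // t _. exact: finite_image_cst.
have := hC _ _ _ _ _ _ mart.
under eq_fun do rewrite max_norm0 max_r ?ge0_ler_powR ?nnegrE ?(ltW p_gt0)//.
by rewrite (expectation_cst _ (y `^ p - (p / (p - 1)) `^ p * `|x| `^ p)) lee_fin.
Qed.

End Optimality.

Theorem corollary4p3 (R : realType) (X : normedModType R) (p : R) (hp : 1 < p) :
  (forall (x : X) (y : R), doob_domain (x, y) ->
     doob_constant p x y (doob_bound p x y) /\
     (forall C : R, doob_constant p x y C -> doob_bound p x y <= C))
  /\
  (forall (x : X) (d : measure_display) (Omega : measurableType d)
      (P : probability Omega R) (F : nat -> set (set Omega))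
      (T : nat) (M : nat -> Omega -> X),
     simple_martingale P F T x M ->
     [/\ ('E_P[fun w => (max_norm M T w `^ p
                         - (p / (p - 1)) `^ p * `|M T w| `^ p)%R]
            <= (- (p / (p - 1) * `|x| `^ p))%:E)%E,
         - (p / (p - 1) * `|x| `^ p) <= 0 &
         (Lnorm P p%:E (fun w => (max_norm M T w)%:E)
            <= (p / (p - 1))%:E * Lnorm P p%:E (fun w => `|M T w|%:E))%E]).
Proof.
have p0 : 0 < p by exact: lt_trans hp.
have p10 : 0 < p - 1 by rewrite subr_gt0.
split=> [x y [/= y0 xy]|x d Omega P F T M martM]; last first.
  split; [exact: doob_inequality martM| |exact: doob_Lnorm_inequality martM].
  by rewrite oppr_le0 mulr_ge0 ?powR_ge0// divr_ge0// ltW.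
split=> [|C hC]; first exact: doob_bound_is_constant.
rewrite /doob_bound; case: ltgtP => [_|yx|xE].
- exact: doob_constant_payoff0.
- exact: doob_bound_minimal_above.
(* At the threshold both expressions for the bound vanish. *)
have yE : y = p / (p - 1) * `|x| by rewrite xE; field; rewrite !gt_eqF.
have := doob_constant_payoff0 hp y0 xy hC; rewrite {1}yE.
rewrite powRM ?divr_ge0 ?(ltW p0) ?(ltW p10)// subrr; apply: le_trans.
by rewrite -[leLHS]/(doob_majorant p `|x| y) yE doob_majorant_eq0.
Qed.
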